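(* Let $G\in\{\mathbf{MALL},\mathbf{AMALL},\mathbf{CLL},\mathbf{ALL}\}$ and let $iG$ be its single-conclusion version ($\mathbf{IMALL},\mathbf{AIMALL},\mathbf{ILL},\mathbf{AILL}$ respectively). For any conservative formula $A$ in the language of $G$ and any $G$-proof $\pi$ of $(\Rightarrow A)$, there is an $iG$-proof $\sigma$ of $(\Rightarrow A)$ with $l(\sigma)\le|\pi|^{O(1)}$.
   Context: Formulas. $\mathcal{L}_b$-formulas are built from atoms and constants $0,1,\top,\bot$ by $\wedge,\vee,*,\to$; $\mathcal{L}_!$-formulas may also use unary $!$. A sequent is $\Gamma\Rightarrow\Delta$, $\Gamma,\Delta$ finite multisets; single-conclusion if $|\Delta|\le1$. Calculi. $\mathbf{MALL}$ (over $\mathcal{L}_b$) has axioms $A\Rightarrow A$, $\Rightarrow1$, $0\Rightarrow$, $\Gamma\Rightarrow\top,\Delta$, $\Gamma,\bot\Rightarrow\Delta$ and rules: from $\Gamma\Rightarrow\Delta$ infer $\Gamma,1\Rightarrow\Delta$ and $\Gamma\Rightarrow0,\Delta$; from $\Gamma,A_i\Rightarrow\Delta$ infer $\Gamma,A_0\wedge A_1\Rightarrow\Delta$; from $\Gamma\Rightarrow A,\Delta$ and $\Gamma\Rightarrow B,\Delta$ infer $\Gamma\Rightarrow A\wedge B,\Delta$; from $\Gamma,A\Rightarrow\Delta$ and $\Gamma,B\Rightarrow\Delta$ infer $\Gamma,A\vee B\Rightarrow\Delta$; from $\Gamma\Rightarrow A_i,\Delta$ infer $\Gamma\Rightarrow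 A_0\vee A_1,\Delta$; from $\Gamma,A,B\Rightarrow\Delta$ infer $\Gamma,A*B\Rightarrow\Delta$; from $\Gamma\Rightarrow A,\Delta$ and $\Sigma\Rightarrow B,\Lambda$ infer $\Gamma,\Sigma\Rightarrow A*B,\Delta,\Lambda$; from $\Gamma\Rightarrow A,\Delta$ and $\Sigma,B\Rightarrow\Lambda$ infer $\Gamma,\Sigma,A\to B\Rightarrow\Delta,\Lambda$; from $\Gamma,A\Rightarrow B,\Delta$ infer $\Gamma\Rightarrow A\to B,\Delta$; cut: from $\Gamma\Rightarrow A,\Delta$ and $\Sigma,A\Rightarrow\Lambda$ infer $\Gamma,\Sigma\Rightarrow\Delta,\Lambda$. $\mathbf{AMALL}$ = $\mathbf{MALL}$ + weakening (from $\Gamma\Rightarrow\Delta$ infer $\Gamma,A\Rightarrow\Delta$ and $\Gamma\Rightarrow A,\Delta$). $\mathbf{CLL}$ (over $\mathcal{L}_!$) = $\mathbf{MALL}$ + the exponential rules: from $!\Gamma\Rightarrow A$ infer $!\Gamma\Rightarrow!A$; from $\Gamma,A\Rightarrow\Delta$ infer $\Gamma,!A\Rightarrow\Delta$; from $\Gamma\Rightarrow\Delta$ infer $\Gamma,!A\Rightarrow\Delta$; from $\Gamma,!A,!A\Rightarrow\Delta$ infer $\Gamma,!A\Rightarrow\Delta$. $\mathbf{ALL}$ = $\mathbf{CLL}$ + weakening. The single-conclusion version restricts all rules to single-conclusion sequents. Size $|\pi|$ = number of symbols; $l(\sigma)$ = total number of formula occurrences in the sequents of $\sigma$. Conservative formulas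 (over $\mathcal{L}_!$; an $\mathcal{L}_b$-formula is (fully) conservative if it is so as an $\mathcal{L}_!$-formula), defined simultaneously: fully conservative $B::=p\mid 1\mid\top\mid B\wedge B\mid B\vee B\mid C\to B$ ($p$ an atom, $C$ conservative); conservative $C::=\bot\mid B\mid C\wedge C\mid C\vee C\mid C*C\mid\ !C$ ($B$ fully conservative). *)

(* Defs.v *)
From Stdlib Require List.
From HB Require Import structures.
From mathcomp Require Import all_boot finmap multiset.

Set Implicit Arguments.
Unset Strict Implicit.
Unset Printing Implicit Defensive.

Local Open Scope mset_scope.

Inductive formula : Type :=
| Atom (n : nat)
| Zero
| One
| Top
| Bot
| And (A B : formula)
| Or (A B : formula)
| Tensor (A B : formula)
| Imp (A B : formula)
| Bang (A : formula).

Fixpoint formula_encode (A : formula) : GenTree.tree nat :=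
  match A with
  | Atom n => GenTree.Leaf n
  | Zero => GenTree.Node 0 [::]
  | One => GenTree.Node 1 [::]
  | Top => GenTree.Node 2 [::]
  | Bot => GenTree.Node 3 [::]
  | And A B => GenTree.Node 4 [:: formula_encode A; formula_encode B]
  | Or A B => GenTree.Node 5 [:: formula_encode A; formula_encode B]
  | Tensor A B => GenTree.Node 6 [:: formula_encode A; formula_encode B]
  | Imp A B => GenTree.Node 7 [:: formula_encode A; formula_encode B]
  | Bang A => GenTree.Node 8 [:: formula_encode A]
  end.

Fixpoint formula_decode (t : GenTree.tree nat) : formula :=
  match t with
  | GenTree.Leaf n => Atom n
  | GenTree.Node 1 _ => One
  | GenTree.Node 2 _ => Top
  | GenTree.Node 3 _ => Bot
  | GenTree.Node 4 [:: t; u] => And (formula_decode t) (formula_decode u)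
  | GenTree.Node 5 [:: t; u] => Or (formula_decode t) (formula_decode u)
  | GenTree.Node 6 [:: t; u] => Tensor (formula_decode t) (formula_decode u)
  | GenTree.Node 7 [:: t; u] => Imp (formula_decode t) (formula_decode u)
  | GenTree.Node 8 [:: t] => Bang (formula_decode t)
  | GenTree.Node _ _ => Zero
  end.

Lemma formula_encodeK : cancel formula_encode formula_decode.
Proof. by elim=> //= [A -> B ->|A -> B ->|A -> B ->|A -> B ->|A ->]. Qed.

HB.instance Definition _ := Choice.copy formula (can_type formula_encodeK).

Fixpoint bang_free (A : formula) : bool :=
  match A with
  | Atom _ | Zero | One | Top | Bot => true
  | And A B | Or A B | Tensor A B | Imp A B => bang_free A && bang_free B
  | Bang _ => false
  end.

Inductive fully_conservative : formula -> Prop :=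
| FC_atom n : fully_conservative (Atom n)
| FC_one : fully_conservative One
| FC_top : fully_conservative Top
| FC_and A B :
    fully_conservative A -> fully_conservative B -> fully_conservative (And A B)
| FC_or A B :
    fully_conservative A -> fully_conservative B -> fully_conservative (Or A B)
| FC_imp A B :
    conservative A -> fully_conservative B -> fully_conservative (Imp A B)
with conservative : formula -> Prop :=
| C_bot : conservative Bot
| C_fully A : fully_conservative A -> conservative A
| C_and A B : conservative A -> conservative B -> conservative (And A B)
| C_or A B : conservative A -> conservative B -> conservative (Or A B)
| C_tensor A B : conservative A -> conservative B -> conservative (Tensor A B)
| C_bang A : conservative A -> conservative (Bang A).

(* The pair (Gamma, Delta) stands for the sequent Gamma => Delta. *)
Definition sequent := ({mset formula} * {mset formula})%type.

Definition single_conclusion (S : sequent) : bool := size S.2 <= 1.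

Inductive calculus : Type := MALL | AMALL | CLL | ALL.

Definition has_weakening (G : calculus) : bool :=
  match G with AMALL | ALL => true | MALL | CLL => false end.

Definition has_exponentials (G : calculus) : bool :=
  match G with CLL | ALL => true | MALL | AMALL => false end.

Definition in_language (G : calculus) (A : formula) : bool :=
  has_exponentials G || bang_free A.

Definition sequent_in_language (G : calculus) (S : sequent) : bool :=
  all (in_language G) S.1 && all (in_language G) S.2.

Inductive rule (G : calculus) : seq sequent -> sequent -> Prop :=
| R_ax A : rule G [::] ([mset A], [mset A])
| R_oneR : rule G [::] (mset0, [mset One])
| R_zeroL : rule G [::] ([mset Zero], mset0)
| R_topR Ga De : rule G [::] (Ga, Top +` De)
| R_botL Ga De : rule G [::] (Bot +` Ga, De)
| R_oneL Ga De : rule G [:: (Ga, De)] (One +` Ga, De)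
| R_zeroR Ga De : rule G [:: (Ga, De)] (Ga, Zero +` De)
| R_andL1 Ga De A B : rule G [:: (A +` Ga, De)] (And A B +` Ga, De)
| R_andL2 Ga De A B : rule G [:: (B +` Ga, De)] (And A B +` Ga, De)
| R_andR Ga De A B :
    rule G [:: (Ga, A +` De); (Ga, B +` De)] (Ga, And A B +` De)
| R_orL Ga De A B :
    rule G [:: (A +` Ga, De); (B +` Ga, De)] (Or A B +` Ga, De)
| R_orR1 Ga De A B : rule G [:: (Ga, A +` De)] (Ga, Or A B +` De)
| R_orR2 Ga De A B : rule G [:: (Ga, B +` De)] (Ga, Or A B +` De)
| R_tensorL Ga De A B :
    rule G [:: (A +` (B +` Ga), De)] (Tensor A B +` Ga, De)
| R_tensorR Ga De Si La A B :
    rule G [:: (Ga, A +` De); (Si, B +` La)]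
      (Ga `+` Si, Tensor A B +` (De `+` La))
| R_impL Ga De Si La A B :
    rule G [:: (Ga, A +` De); (B +` Si, La)]
      (Imp A B +` (Ga `+` Si), De `+` La)
| R_impR Ga De A B : rule G [:: (A +` Ga, B +` De)] (Ga, Imp A B +` De)
| R_cut Ga De Si La A :
    rule G [:: (Ga, A +` De); (A +` Si, La)] (Ga `+` Si, De `+` La)
| R_weakL Ga De A : has_weakening G -> rule G [:: (Ga, De)] (A +` Ga, De)
| R_weakR Ga De A : has_weakening G -> rule G [:: (Ga, De)] (Ga, A +` De)
| R_promotion (Ga : seq formula) A : has_exponentials G ->
    rule G [:: (seq_mset [seq Bang C | C <- Ga], [mset A])]
      (seq_mset [seq Bang C | C <- Ga], [mset Bang A])
| R_dereliction Ga De A : has_exponentials G ->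
    rule G [:: (A +` Ga, De)] (Bang A +` Ga, De)
| R_bang_weak Ga De A : has_exponentials G ->
    rule G [:: (Ga, De)] (Bang A +` Ga, De)
| R_bang_contr Ga De A : has_exponentials G ->
    rule G [:: (Bang A +` (Bang A +` Ga), De)] (Bang A +` Ga, De).

(* The rules of G applied to sequents in the language of G: in MALL and AMALL
   this keeps ! out of cut formulas and of axiom and weakening contexts. *)
Definition inference (G : calculus) (Ps : seq sequent) (S : sequent) : Prop :=
  rule G Ps S /\ all (sequent_in_language G) (S :: Ps).

Definition single_inference (G : calculus) (Ps : seq sequent) (S : sequent) :
    Prop :=
  inference G Ps S /\ all single_conclusion (S :: Ps).

(* Dag-like proofs, as sequences of sequents. *)
Definition dag_proof (R : seq sequent -> sequent -> Prop) (pi : seq sequent)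
    (S : sequent) : Prop :=
  (exists pi', pi = rcons pi' S) /\
  (forall pre T post, pi = pre ++ T :: post ->
     exists2 Ps, {subset Ps <= pre} & R Ps T).

Inductive ptree : Type := Node (S : sequent) (ts : seq ptree).

Definition root (t : ptree) : sequent := let: Node T _ := t in T.

Fixpoint sequents (t : ptree) : seq sequent :=
  let: Node T ts := t in T :: flatten [seq sequents u | u <- ts].

Inductive derivation (R : seq sequent -> sequent -> Prop) : ptree -> Prop :=
| Derivation S ts :
    R [seq root t | t <- ts] S ->
    (forall t, List.In t ts -> derivation R t) ->
    derivation R (Node S ts).

Definition tree_proof (R : seq sequent -> sequent -> Prop) (t : ptree)
    (S : sequent) : Prop :=
  derivation R t /\ root t = S.

Fixpoint formula_size (A : formula) : nat :=
  match A with
  | Atom _ | Zero | One | Top | Bot => 1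
  | And A B | Or A B | Tensor A B | Imp A B =>
      (formula_size A + formula_size B).+1
  | Bang A => (formula_size A).+1
  end.

(* The successor accounts for the sequent arrow; parentheses and commas are not
   counted, so that |pi| is as small as possible in the bound l <= |pi|^c. *)
Definition sequent_size (S : sequent) : nat :=
  (\sum_(A <- S.1) formula_size A + \sum_(A <- S.2) formula_size A).+1.

Definition symbols (pi : seq sequent) : nat := \sum_(S <- pi) sequent_size S.

Definition occurrences (pi : seq sequent) : nat :=
  \sum_(S <- pi) (size S.1 + size S.2).

(* Main.v *)
From mathcomp Require Import all_boot finmap multiset zify.
Require Import Defs.

(** Formulas are interpreted by the Chu construction over the single-conclusion
calculus with dualizing object [Bot]: each [A] gets a formula [A+] of proofs and
a formula [A-] of refutations with [A+, A- => Bot]. A sequent [Ga => De] becomes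
the single formula that is the additive conjunction of the implications
obtained by moving one of its formulas to the right (of [Ga+, De-] without that
formula) or none (with [Bot] on the right). Every rule of the multi-conclusion
calculus then has a derivation of polynomially many formula occurrences from its
translated premises. A premise may be needed for several conjuncts, but only in
additively separated branches, so it is used once: this is what keeps tree-like
proofs polynomial. The formulas themselves can grow exponentially.

An atom is interpreted by [(p, Bot)]. Hence [B- => Bot] for fully conservative
[B], which makes the second conjunct of [(C -> B)+ = (C+ -> B+) /\ (B- -> C-)]
vacuous, and [A+] is equivalent to [A] for every conservative [A]. *)

Set Implicit Arguments.
Unset Strict Implicit.
Unset Printing Implicit Defensive.

Local Open Scope mset_scope.

(** * Single-conclusion derivations with bounds *)

(* In [ideriv G w k H Ga C] the derivation of the single-conclusion sequent
   [Ga => C] has at most [k] inferences and all its antecedents have fewer than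
   [w] formulas; [H] lists its open leaves [=> A], each used exactly once. No
   language condition is imposed: see [erase]. *)
Inductive ideriv (G : calculus) (w : nat) :
    nat -> seq formula -> seq formula -> formula -> Prop :=
| I_hyp A : 0 < w -> ideriv G w 0 [:: A] [::] A
| I_mono k k' H Ga C :
    ideriv G w k H Ga C -> k <= k' -> ideriv G w k' H Ga C
| I_exch k H Ga Ga' C :
    perm_eq Ga Ga' -> ideriv G w k H Ga C -> ideriv G w k H Ga' C
| I_ax A : 1 < w -> ideriv G w 1 [::] [:: A] A
| I_oneR : 0 < w -> ideriv G w 1 [::] [::] One
| I_topR Ga : size Ga < w -> ideriv G w 1 [::] Ga Top
| I_botL Ga C : (size Ga).+1 < w -> ideriv G w 1 [::] (Bot :: Ga) C
| I_oneL k H Ga C : (size Ga).+1 < w ->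
    ideriv G w k H Ga C -> ideriv G w k.+1 H (One :: Ga) C
| I_andL1 k H Ga A B C : (size Ga).+1 < w ->
    ideriv G w k H (A :: Ga) C -> ideriv G w k.+1 H (And A B :: Ga) C
| I_andL2 k H Ga A B C : (size Ga).+1 < w ->
    ideriv G w k H (B :: Ga) C -> ideriv G w k.+1 H (And A B :: Ga) C
| I_andR k1 k2 H1 H2 Ga A B : size Ga < w ->
    ideriv G w k1 H1 Ga A -> ideriv G w k2 H2 Ga B ->
    ideriv G w (k1 + k2).+1 (H1 ++ H2) Ga (And A B)
| I_orL k1 k2 H1 H2 Ga A B C : (size Ga).+1 < w ->
    ideriv G w k1 H1 (A :: Ga) C -> ideriv G w k2 H2 (B :: Ga) C ->
    ideriv G w (k1 + k2).+1 (H1 ++ H2) (Or A B :: Ga) C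
| I_orR1 k H Ga A B : size Ga < w ->
    ideriv G w k H Ga A -> ideriv G w k.+1 H Ga (Or A B)
| I_orR2 k H Ga A B : size Ga < w ->
    ideriv G w k H Ga B -> ideriv G w k.+1 H Ga (Or A B)
| I_tensorL k H Ga A B C : (size Ga).+1 < w ->
    ideriv G w k H (A :: B :: Ga) C -> ideriv G w k.+1 H (Tensor A B :: Ga) C
| I_tensorR k1 k2 H1 H2 Ga Si A B : size Ga + size Si < w ->
    ideriv G w k1 H1 Ga A -> ideriv G w k2 H2 Si B ->
    ideriv G w (k1 + k2).+1 (H1 ++ H2) (Ga ++ Si) (Tensor A B)
| I_impL k1 k2 H1 H2 Ga Si A B C : (size Ga + size Si).+1 < w ->
    ideriv G w k1 H1 Ga A -> ideriv G w k2 H2 (B :: Si) C ->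
    ideriv G w (k1 + k2).+1 (H1 ++ H2) (Imp A B :: Ga ++ Si) C
| I_impR k H Ga A B : size Ga < w ->
    ideriv G w k H (A :: Ga) B -> ideriv G w k.+1 H Ga (Imp A B)
| I_cut k1 k2 H1 H2 Ga Si A C : size Ga + size Si < w ->
    ideriv G w k1 H1 Ga A -> ideriv G w k2 H2 (A :: Si) C ->
    ideriv G w (k1 + k2).+1 (H1 ++ H2) (Ga ++ Si) C
| I_weakL k H Ga A C : has_weakening G -> (size Ga).+1 < w ->
    ideriv G w k H Ga C -> ideriv G w k.+1 H (A :: Ga) C
| I_promotion k H Ga A : has_exponentials G -> size Ga < w ->
    ideriv G w k H (map Bang Ga) A -> ideriv G w k.+1 H (map Bang Ga) (Bang A)
| I_dereliction k H Ga A C : has_exponentials G -> (size Ga).+1 < w ->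
    ideriv G w k H (A :: Ga) C -> ideriv G w k.+1 H (Bang A :: Ga) C
| I_bang_weak k H Ga A C : has_exponentials G -> (size Ga).+1 < w ->
    ideriv G w k H Ga C -> ideriv G w k.+1 H (Bang A :: Ga) C
| I_bang_contr k H Ga A C : has_exponentials G -> (size Ga).+1 < w ->
    ideriv G w k H (Bang A :: Bang A :: Ga) C ->
    ideriv G w k.+1 H (Bang A :: Ga) C.

Notation iclosed G w k Ga C := (ideriv G w k [::] Ga C).

Section Closed.
Context (G : calculus) (w : nat).

Lemma closed_andR k1 k2 Ga A B : size Ga < w ->
  iclosed G w k1 Ga A -> iclosed G w k2 Ga B ->
  iclosed G w (k1 + k2).+1 Ga (And A B).
Proof. exact: (@I_andR G w k1 k2 [::] [::]). Qed.

Lemma closed_orL k1 k2 Ga A B C : (size Ga).+1 < w ->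
  iclosed G w k1 (A :: Ga) C -> iclosed G w k2 (B :: Ga) C ->
  iclosed G w (k1 + k2).+1 (Or A B :: Ga) C.
Proof. exact: (@I_orL G w k1 k2 [::] [::]). Qed.

Lemma closed_tensorR k1 k2 Ga Si A B : size Ga + size Si < w ->
  iclosed G w k1 Ga A -> iclosed G w k2 Si B ->
  iclosed G w (k1 + k2).+1 (Ga ++ Si) (Tensor A B).
Proof. exact: (@I_tensorR G w k1 k2 [::] [::]). Qed.

Lemma closed_impL k1 k2 Ga Si A B C : (size Ga + size Si).+1 < w ->
  iclosed G w k1 Ga A -> iclosed G w k2 (B :: Si) C ->
  iclosed G w (k1 + k2).+1 (Imp A B :: Ga ++ Si) C.
Proof. exact: (@I_impL G w k1 k2 [::] [::]). Qed.

Lemma closed_cut k1 k2 Ga Si A C : size Ga + size Si < w ->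
  iclosed G w k1 Ga A -> iclosed G w k2 (A :: Si) C ->
  iclosed G w (k1 + k2).+1 (Ga ++ Si) C.
Proof. exact: (@I_cut G w k1 k2 [::] [::]). Qed.

End Closed.

(** * The Chu translation *)

(* [chu true A] and [chu false A] are the formulas of proofs and of refutations
   of [A], for the dualizing object [Bot]. *)
Fixpoint chu (b : bool) (A : formula) : formula :=
  match A with
  | Atom n => if b then Atom n else Bot
  | Zero => if b then Bot else One
  | One => if b then One else Bot
  | Top => if b then Top else Bot
  | Bot => if b then Bot else Top
  | And A B =>
      if b then And (chu true A) (chu true B)
      else Or (chu false A) (chu false B)
  | Or A B =>
      if b then Or (chu true A) (chu true B)
      else And (chu false A) (chu false B)
  | Tensor A B =>
      if b then Tensor (chu true A) (chu true B)
      else And (Imp (chu true A) (chu false B)) (Imp (chu true B) (chu false A))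
  | Imp A B =>
      if b then And (Imp (chu true A) (chu true B))
                    (Imp (chu false B) (chu false A))
      else Tensor (chu true A) (chu false B)
  | Bang A => if b then Bang (chu true A) else Imp (Bang (chu true A)) Bot
  end.

(* [(true, A)] stands for [A] in an antecedent, [(false, A)] for [A] in a
   succedent. *)
Notation entry := (bool * formula)%type.
Definition inn (e : entry) : formula := chu e.1 e.2.
Definition out (e : entry) : formula := chu (~~ e.1) e.2.

Definition curry (es : seq entry) (g : formula) : formula :=
  foldr (fun e => Imp (inn e)) g es.

Fixpoint par (es : seq entry) : formula :=
  if es is x :: es' then And (Imp (inn x) (par es')) (curry es' (out x))
  else Bot.

(* [par es] is an iterated additive conjunction of the implications from the
   multiset [map inn rest] to [o], for the pairs [(rest, o)] singled out here:
   one entry at a time is moved to the right, or none, with [Bot] there. *)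
Definition target (es rest : seq entry) (o : formula) : Prop :=
  (perm_eq es rest /\ o = Bot) \/
  (exists2 e, perm_eq es (e :: rest) & o = out e).

(** * Tactics for lengths and permutations *)

Ltac perm_sizes :=
  repeat match goal with
  | H : is_true (perm_eq _ _) |- _ =>
      generalize (perm_size H); clear H
  end.
Ltac width :=
  perm_sizes;
  rewrite /= ?size_cat /= ?size_cat ?size_map /= ?size_cat ?size_map; lia.

(** Permutations are decided by counting. When [p] is a predicate on formulas and [H] permutes
    entries, the entries are counted through [inn], as the goal then concerns lists [map inn _]. *)
Ltac count_hyp H p :=
  first [ generalize (elimT permP H p)
        | generalize (elimT permP H (preim inn p)) ]; clear H.
Ltac permute :=
  let p := fresh "p" in
  apply/permP => p;
  repeat match goal with
  | H : is_true (perm_eq _ _) |- _ => count_hyp H p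
  end;
  rewrite /= ?count_cat ?count_map /= ?count_cat ?count_map /=; lia.

(** * Which entry is moved to the right *)

Lemma target_perm es es' rest o :
  perm_eq es es' -> target es rest o -> target es' rest o.
Proof.
move=> h [[h' ->]|[e h' ->]]; [left; split=> // | right; exists e => //];
  by permute.
Qed.

(** This is the case split behind every rule: the principal entry [x] either stays on the left or is
    itself the one moved to the right. *)
Lemma target_cons x es rest o : target (x :: es) rest o ->
  (exists2 r, target es r o & perm_eq rest (x :: r)) \/
  (perm_eq rest es /\ o = out x).
Proof.
case=> [[h ->]|[e h ->]].
  by left; exists es; [left|rewrite perm_sym].
have [exE|ex] := eqVneq e x.
  by right; rewrite -exE in h *; split=> //; rewrite perm_sym -(perm_cons e).
have ein : e \in es.
  by have := perm_mem h e; rewrite !inE eqxx (negPf ex).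
have h2 := perm_to_rem ein.
left; exists (rem e es); first by right; exists e.
by permute.
Qed.

(** For rules that split the context: one premise supplies the moved entry and the other keeps its
    whole context on the left. If no entry is moved, the choice is free and falls on [e1]. *)
Lemma target_cat e1 e2 rest o : target (e1 ++ e2) rest o ->
  (exists2 r, target e1 r o & perm_eq rest (r ++ e2)) \/
  (exists2 r, target e2 r o & perm_eq rest (e1 ++ r)).
Proof.
case=> [[h ->]|[e h ->]].
  by left; exists e1; [left|rewrite perm_sym].
have : e \in e1 ++ e2 by rewrite (perm_mem h) inE eqxx.
rewrite mem_cat => /orP[] /perm_to_rem h2.
- left; exists (rem e e1); first by right; exists e.
  by permute.
- right; exists (rem e e2); first by right; exists e.
  by permute.
Qed.

Lemma target_self x es rest : perm_eq es (x :: rest) -> target es rest (out x).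
Proof. by right; exists x. Qed.

Lemma target_size es rest o : target es rest o -> size rest <= size es.
Proof. by case=> [[/perm_size-> _]|[e /perm_size-> _]] //=. Qed.

Lemma target_ctx x es r o es' : target es r o ->
  perm_eq es' (x :: es) -> target es' (x :: r) o.
Proof.
case=> [[h ->]|[e h ->]] h1; [left; split=> // | right; exists e => //];
  by permute.
Qed.

(** * Pairing of proofs with refutations, and introduction and elimination of [par] *)

Section Chu.
Context (G : calculus) (w : nat).
Local Notation D k Ga C := (iclosed G w k Ga C).

(** For [Tensor] and [Imp] one of the two dual implications suffices, applied to an axiom, so only
    the induction hypothesis for [B] is used; for [And] and [Or] each hypothesis is used once. Hence
    the bound is linear. *)
Lemma compat A : 3 < w ->
  D (6 * formula_size A) [:: chu true A; chu false A] Bot.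
Proof.
move=> w3; have w2 := ltnW w3; have w1 := ltnW w2.
have sw B C k : D k [:: B; C] Bot -> D k [:: C; B] Bot.
  by apply: I_exch; permute.
elim: A => [n|||||A IA B IB|A IA B IB|A IA B IB|A IA B IB|A IA] /=.
- by apply/sw; apply: I_mono; [apply: I_botL|].
- by apply: I_mono; [apply: I_botL|].
- by apply/sw; apply: I_mono; [apply: I_botL|].
- by apply/sw; apply: I_mono; [apply: I_botL|].
- by apply: I_mono; [apply: I_botL|].
- apply/sw; apply: I_mono; first apply: closed_orL => //.
  + by apply/sw; apply: I_andL1 => //; exact: IA.
  + by apply/sw; apply: I_andL2 => //; exact: IB.
  + lia.
- apply: I_mono; first apply: closed_orL => //.
  + by apply/sw; apply: I_andL1 => //; apply/sw; exact: IA.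
  + by apply/sw; apply: I_andL2 => //; apply/sw; exact: IB.
  + lia.
- apply/sw; apply: I_mono; first apply: I_andL1 => //.
    apply/sw; apply: I_tensorL => //.
    apply: (@I_exch _ _ _ _ (Imp (chu true A) (chu false B) ::
             [:: chu true A] ++ [:: chu true B])); first by permute.
    by apply: closed_impL => //; [apply: I_ax; lia | apply/sw; exact: IB].
  lia.
- apply: I_mono; first apply: I_andL1 => //.
    apply/sw; apply: I_tensorL => //.
    apply: (@I_exch _ _ _ _ (Imp (chu true A) (chu true B) ::
             [:: chu true A] ++ [:: chu false B])); first by permute.
    by apply: closed_impL => //; [apply: I_ax; lia | exact: IB].
  lia.
- apply/sw; apply: I_mono.
    apply: (@closed_impL _ _ _ _ [:: Bang (chu true A)] [::]) => //.
      by apply: I_ax; lia.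
    by apply: I_ax; lia.
  lia.
Qed.

Lemma curry_elim es g : (size es).+1 < w ->
  D (2 * size es).+1 (curry es g :: map inn es) g.
Proof.
elim: es => [|e es IH] /= hw; first by apply: I_ax.
apply: I_mono; first apply: (@closed_impL _ _ _ _ [:: inn e] (map inn es)).
- by width.
- by apply: I_ax; lia.
- by apply: IH; lia.
- lia.
Qed.

Lemma curry_intro k H es g Th : size Th + size es < w ->
  ideriv G w k H (Th ++ map inn es) g ->
  ideriv G w (k + size es) H Th (curry es g).
Proof.
elim: es Th => [|e es IH] Th /= hw; first by rewrite cats0 addn0.
move=> h; rewrite addnS; apply: I_impR; first lia.
apply: IH; first by rewrite /=; lia.
by apply: I_exch h; permute.
Qed.

(** An entry that stays on the left is fed to the first conjunct, and the descent continues; at the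
    moved entry the second conjunct is uncurried. If none is moved, the descent ends in [Bot]. *)
Lemma par_elim es rest o : target es rest o -> (size es).+1 < w ->
  D (3 * size es).+1 (par es :: map inn rest) o.
Proof.
elim: es rest => [|x es IH] rest t hw.
  case: t => [[h ->]|[e h]]; last by have := perm_size h.
  have -> : rest = [::] by apply/eqP; rewrite -size_eq0 -(perm_size h).
  by apply: I_ax.
rewrite /= in hw *; have /= sr := target_size t.
case: (target_cons t) => [[r tr h]|[h ->]].
- apply: (@I_exch _ _ _ _ (par (x :: es) :: inn x :: map inn r)).
    by permute.
  have sr' := target_size tr.
  apply: I_mono; first apply: I_andL1; first by width.
    apply: (@closed_impL _ _ _ _ [:: inn x] (map inn r)); first by width.
      by apply: I_ax; lia.
    by apply: IH => //; lia.
  lia.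
- apply: (@I_exch _ _ _ _ (par (x :: es) :: map inn es)); first by permute.
  apply: I_mono; first apply: I_andL2; first by width.
    by apply: curry_elim; lia.
  lia.
Qed.

(** The additive right rule copies [Th] into each of the [(size es).+1] branches, one per target, so
    every branch can consume [Th] and the costs of the branches merely add up. *)
Lemma par_intro k es Th : size Th + size es < w ->
  (forall rest o, target es rest o -> D k (Th ++ map inn rest) o) ->
  D ((size es).+1 * (k + size es + 3)) Th (par es).
Proof.
elim: es Th => [|x es IH] Th hw h.
  apply: I_mono; first by have := h [::] Bot; rewrite cats0; apply; left.
  lia.
rewrite /= in hw *; apply: I_mono; first apply: closed_andR; first by lia.
- apply: I_impR; first by lia.
  apply: IH; first by rewrite /=; lia.
  move=> rest o t.
  apply: (I_exch _ (h (x :: rest) o _)); first by permute.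
  exact: target_ctx t _.
- apply: curry_intro; first by lia.
  by apply: h; right; exists x.
- lia.
Qed.

End Chu.

(** * Translation of the rules *)

Ltac perm_to Ga := apply: (@I_exch _ _ _ _ Ga); first by permute.

Section Rules.
Context (G : calculus) (w : nat).
Local Notation D k Ga C := (iclosed G w k Ga C).
Implicit Types (x a b : entry) (es rest : seq entry).

Lemma par_use es1 rest1 o Ga : target es1 rest1 o ->
  perm_eq Ga (par es1 :: map inn rest1) -> (size es1).+1 < w ->
  D (3 * size es1).+1 Ga o.
Proof.
by move=> t h hw; apply: I_exch (par_elim G t hw); rewrite perm_sym.
Qed.

(** Signed entries let one argument serve dual rules: here [And] on the left and [Or] on the right,
    with [c] the chosen component. The lemmas below pair rules in the same way. *)
Lemma rule_choice x a b c es es1 e0 rest o :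
  inn x = And (inn a) (inn b) -> out x = Or (out a) (out b) ->
  c = a \/ c = b ->
  perm_eq es (x :: e0) -> perm_eq es1 (c :: e0) -> size es + 4 < w ->
  target es rest o -> D (6 * size es + 20) (par es1 :: map inn rest) o.
Proof.
move=> ix ox hc h h1 hw /(target_perm h)/target_cons[[r tr hr]|[hr ->]].
- perm_to (inn x :: par es1 :: map inn r); rewrite ix.
  have sr := target_size tr.
  have d : D (3 * size es1).+1 (inn c :: par es1 :: map inn r) o.
    apply: (@par_use es1 (c :: r)); [exact: target_ctx tr h1 | | by width].
    by permute.
  apply: (@I_mono _ _ (3 * size es1).+2); last by width.
  by case: hc d => ->; [apply: I_andL1 | apply: I_andL2]; width.
- have d : D (3 * size es1).+1 (par es1 :: map inn rest) (out c).
    apply: (@par_use es1 rest); [apply: target_self | by [] | by width].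
    by permute.
  rewrite ox; apply: (@I_mono _ _ (3 * size es1).+2); last by width.
  by case: hc d => ->; [apply: I_orR1 | apply: I_orR2]; width.
Qed.

(** [And] on the right and [Or] on the left. The premises come as one conjunction, so that each
    branch can project the premise it needs without having to discard the other. *)
Lemma rule_additive x a b es es1 es2 e0 rest o :
  inn x = Or (inn a) (inn b) -> out x = And (out a) (out b) ->
  perm_eq es (x :: e0) -> perm_eq es1 (a :: e0) -> perm_eq es2 (b :: e0) ->
  size es + 4 < w -> target es rest o ->
  D (6 * size es + 20) (And (par es1) (par es2) :: map inn rest) o.
Proof.
move=> ix ox h h1 h2 hw /(target_perm h)/target_cons[[r tr hr]|[hr ->]].
- perm_to (inn x :: And (par es1) (par es2) :: map inn r); rewrite ix.
  have sr := target_size tr.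
  apply: I_mono; first apply: closed_orL; first by width.
  + perm_to (And (par es1) (par es2) :: inn a :: map inn r).
    apply: I_andL1; first by width.
    apply: (@par_use es1 (a :: r)); [exact: target_ctx tr h1 | | by width].
    by permute.
  + perm_to (And (par es1) (par es2) :: inn b :: map inn r).
    apply: I_andL2; first by width.
    apply: (@par_use es2 (b :: r)); [exact: target_ctx tr h2 | | by width].
    by permute.
  + by width.
- rewrite ox; apply: I_mono; first apply: closed_andR; first by width.
  + apply: I_andL1; first by width.
    apply: (@par_use es1 rest); [apply: target_self | | by width].
      by permute.
    by permute.
  + apply: I_andL2; first by width.
    apply: (@par_use es2 rest); [apply: target_self | | by width].
      by permute.
    by permute.
  + by width.
Qed.

Lemma rule_unit x es es1 e0 rest o :
  inn x = One -> out x = Bot ->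
  perm_eq es (x :: e0) -> perm_eq es1 e0 -> size es + 4 < w ->
  target es rest o -> D (6 * size es + 20) (par es1 :: map inn rest) o.
Proof.
move=> ix ox h h1 hw /(target_perm h)/target_cons[[r tr hr]|[hr ->]].
- perm_to (inn x :: par es1 :: map inn r); rewrite ix.
  have sr := target_size tr.
  apply: I_mono; first apply: I_oneL; first by width.
    apply: (@par_use es1 r); [|by permute|by width].
    by apply: target_perm tr; rewrite perm_sym.
  by width.
- rewrite ox; apply: I_mono.
    (* Here [out x] is [Bot], which is the conjunct of the premise with no entry moved. *)
    apply: (@par_use es1 rest); [left; split=> // | | by width].
      by permute.
    by permute.
  by width.
Qed.

(** [Tensor] on the left and [Imp] on the right. With [x] on the right, the two implications in
    [out x] are the two ways to move one of [a], [b] and keep the other. *)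
Lemma rule_join x a b es es1 e0 rest o :
  inn x = Tensor (inn a) (inn b) ->
  out x = And (Imp (inn a) (out b)) (Imp (inn b) (out a)) ->
  perm_eq es (x :: e0) -> perm_eq es1 (a :: b :: e0) -> size es + 4 < w ->
  target es rest o -> D (6 * size es + 20) (par es1 :: map inn rest) o.
Proof.
move=> ix ox h h1 hw /(target_perm h)/target_cons[[r tr hr]|[hr ->]].
- perm_to (inn x :: par es1 :: map inn r); rewrite ix.
  have sr := target_size tr.
  apply: I_mono; first apply: I_tensorL; first by width.
    apply: (@par_use es1 (a :: b :: r)); [|by permute|by width].
    exact: target_ctx (target_ctx tr (perm_refl _)) h1.
  by width.
- rewrite ox; apply: I_mono; first apply: closed_andR; first by width.
  + apply: I_impR; first by width.
    apply: (@par_use es1 (a :: rest)); [apply: target_self | | by width].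
      by permute.
    by permute.
  + apply: I_impR; first by width.
    apply: (@par_use es1 (b :: rest)); [apply: target_self | | by width].
      by permute.
    by permute.
  + by width.
Qed.

(** [Tensor] on the right and [Imp] on the left. If [x] stays on the left, the premise that does not
    supply the moved entry proves [out a] or [out b]; the matching implication in [inn x] turns this
    into the component that the other premise needs. *)
Lemma rule_split x a b es es1 es2 e1 e2 rest o :
  inn x = And (Imp (out a) (inn b)) (Imp (out b) (inn a)) ->
  out x = Tensor (out a) (out b) ->
  perm_eq es (x :: e1 ++ e2) -> perm_eq es1 (a :: e1) ->
  perm_eq es2 (b :: e2) -> size es + 4 < w -> target es rest o ->
  D (6 * size es + 20) (par es1 :: par es2 :: map inn rest) o.
Proof.
move=> ix ox h h1 h2 hw /(target_perm h)/target_cons[[r tr hr]|[hr ->]].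
- case/target_cat: tr => -[r' tr hr']; have sr := target_size tr.
  + perm_to (inn x :: (par es2 :: map inn e2) ++ (par es1 :: map inn r')).
    rewrite ix; apply: I_mono; first apply: I_andL2; first by width.
      apply: closed_impL; first by width.
        by apply: (@par_use es2 e2); [exact: target_self | | width].
      apply: (@par_use es1 (a :: r')); [exact: target_ctx tr h1 | | by width].
      by permute.
    by width.
  + perm_to (inn x :: (par es1 :: map inn e1) ++ (par es2 :: map inn r')).
    rewrite ix; apply: I_mono; first apply: I_andL1; first by width.
      apply: closed_impL; first by width.
        by apply: (@par_use es1 e1); [exact: target_self | | width].
      apply: (@par_use es2 (b :: r')); [exact: target_ctx tr h2 | | by width].
      by permute.
    by width.
- perm_to ((par es1 :: map inn e1) ++ (par es2 :: map inn e2)); rewrite ox.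
  apply: I_mono; first apply: closed_tensorR; first by width.
  + by apply: (@par_use es1 e1); [exact: target_self | | width].
  + by apply: (@par_use es2 e2); [exact: target_self | | width].
  + by width.
Qed.

(** The two sides of the cut formula are dual entries. The premise without the moved entry becomes
    the left premise of the new cut, so the cut formula is [chu true A] or [chu false A] depending
    on the target. *)
Lemma rule_cut a b es es1 es2 e1 e2 rest o :
  inn a = out b -> inn b = out a ->
  perm_eq es (e1 ++ e2) -> perm_eq es1 (a :: e1) ->
  perm_eq es2 (b :: e2) -> size es + 4 < w -> target es rest o ->
  D (6 * size es + 20) (par es1 :: par es2 :: map inn rest) o.
Proof.
move=> ia ib h h1 h2 hw /(target_perm h)/target_cat[] [r tr hr];
  have sr := target_size tr.
- perm_to ((par es2 :: map inn e2) ++ (par es1 :: map inn r)).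
  apply: I_mono; first apply: (@closed_cut _ _ _ _ _ _ (out b)); first by width.
  + by apply: (@par_use es2 e2); [exact: target_self | | width].
  + rewrite -ia.
    apply: (@par_use es1 (a :: r)); [exact: target_ctx tr h1 | | by width].
    by permute.
  + by width.
- perm_to ((par es1 :: map inn e1) ++ (par es2 :: map inn r)).
  apply: I_mono; first apply: (@closed_cut _ _ _ _ _ _ (out a)); first by width.
  + by apply: (@par_use es1 e1); [exact: target_self | | width].
  + rewrite -ib.
    apply: (@par_use es2 (b :: r)); [exact: target_ctx tr h2 | | by width].
    by permute.
  + by width.
Qed.

Lemma rule_weak x es es1 e0 rest o : has_weakening G ->
  perm_eq es (x :: e0) -> perm_eq es1 e0 -> size es + 4 < w ->
  target es rest o -> D (6 * size es + 20) (par es1 :: map inn rest) o.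
Proof.
move=> wk h h1 hw /(target_perm h)/target_cons[[r tr hr]|[hr ->]].
- perm_to (inn x :: par es1 :: map inn r).
  have sr := target_size tr.
  apply: I_mono; first apply: I_weakL => //; first by width.
    apply: (@par_use es1 r); [|by permute|by width].
    by apply: target_perm tr; rewrite perm_sym.
  by width.
- perm_to ((par es1 :: map inn rest) ++ [::]).
  (* Weakening on the right becomes ex falso: the premise with no entry moved gives [Bot], and [Bot]
     gives any [out x]. *)
  apply: I_mono; first apply: (@closed_cut _ _ _ _ _ _ Bot); first by width.
    apply: (@par_use es1 rest); [left; split=> // | by [] | by width].
    by permute.
    by apply: I_botL; width.
  by width.
Qed.

Lemma rule_ax a b es k rest o : inn a = out b -> inn b = out a ->
  perm_eq es [:: a; b] -> 1 < w -> D k [:: inn a; inn b] Bot ->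
  target es rest o -> D k.+1 (map inn rest) o.
Proof.
move=> ia ib h hw d /(target_perm h)/target_cons[[r tr hr]|[hr ->]].
- case/target_cons: tr => [[r' tr' hr']|[hr' ->]].
  + case: tr' => [[hr2 ->]|[e hr2]]; last by have := perm_size hr2.
    perm_to [:: inn a; inn b].
    by apply: I_mono d _.
  + perm_to [:: inn a].
    by rewrite ia; apply: I_mono; first apply: I_ax.
- perm_to [:: inn b].
  by rewrite ib; apply: I_mono; first apply: I_ax.
Qed.

Lemma rule_top x es e0 rest o : inn x = Bot -> out x = Top ->
  perm_eq es (x :: e0) -> size es + 4 < w ->
  target es rest o -> D 1 (map inn rest) o.
Proof.
move=> ix ox h hw /(target_perm h)/target_cons[[r tr hr]|[hr ->]].
- perm_to (inn x :: map inn r); rewrite ix; have sr := target_size tr.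
  by apply: I_botL; width.
- by rewrite ox; apply: I_topR; width.
Qed.

Lemma rule_one x es rest o : inn x = Bot -> out x = One ->
  perm_eq es [:: x] -> 1 < w -> target es rest o -> D 1 (map inn rest) o.
Proof.
move=> ix ox h hw /(target_perm h)/target_cons[[r tr hr]|[hr ->]].
- perm_to (inn x :: map inn r); rewrite ix; have /= sr := target_size tr.
  by apply: I_botL; width.
- perm_to (@nil formula).
  by rewrite ox; apply: I_oneR; lia.
Qed.

(** A banged entry moved to the right is a negation, so introducing the implication puts the [Bang]
    back on the left with goal [Bot]. Both cases thus end in the left rule for [Bang]; the next two
    lemmas share this pattern. *)
Lemma rule_derel x a es es1 e0 rest o : has_exponentials G ->
  inn x = Bang (inn a) -> out x = Imp (Bang (inn a)) Bot ->
  perm_eq es (x :: e0) -> perm_eq es1 (a :: e0) -> size es + 4 < w ->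
  target es rest o -> D (6 * size es + 20) (par es1 :: map inn rest) o.
Proof.
move=> ex ix ox h h1 hw /(target_perm h)/target_cons[[r tr hr]|[hr ->]].
- perm_to (inn x :: par es1 :: map inn r); rewrite ix.
  have sr := target_size tr.
  apply: I_mono; first apply: I_dereliction => //; first by width.
    apply: (@par_use es1 (a :: r)); [exact: target_ctx tr h1 | | by width].
    by permute.
  by width.
- rewrite ox; apply: I_mono; first apply: I_impR; first by width.
    apply: I_dereliction => //; first by width.
    apply: (@par_use es1 (a :: rest)); [left; split=> // | | by width].
      by permute.
    by permute.
  by width.
Qed.

Lemma rule_bang_weak x a es es1 e0 rest o : has_exponentials G ->
  inn x = Bang (inn a) -> out x = Imp (Bang (inn a)) Bot ->
  perm_eq es (x :: e0) -> perm_eq es1 e0 -> size es + 4 < w ->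
  target es rest o -> D (6 * size es + 20) (par es1 :: map inn rest) o.
Proof.
move=> ex ix ox h h1 hw /(target_perm h)/target_cons[[r tr hr]|[hr ->]].
- perm_to (inn x :: par es1 :: map inn r); rewrite ix.
  have sr := target_size tr.
  apply: I_mono; first apply: I_bang_weak => //; first by width.
    apply: (@par_use es1 r); [|by permute|by width].
    by apply: target_perm tr; rewrite perm_sym.
  by width.
- rewrite ox; apply: I_mono; first apply: I_impR; first by width.
    apply: I_bang_weak => //; first by width.
    apply: (@par_use es1 rest); [left; split=> // | | by width].
      by permute.
    by permute.
  by width.
Qed.

Lemma rule_bang_contr x a es es1 e0 rest o : has_exponentials G ->
  inn x = Bang (inn a) -> out x = Imp (Bang (inn a)) Bot ->
  perm_eq es (x :: e0) -> perm_eq es1 (x :: x :: e0) -> size es + 4 < w ->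
  target es rest o -> D (6 * size es + 20) (par es1 :: map inn rest) o.
Proof.
move=> ex ix ox h h1 hw /(target_perm h)/target_cons[[r tr hr]|[hr ->]].
- perm_to (inn x :: par es1 :: map inn r); rewrite ix.
  have sr := target_size tr.
  apply: I_mono; first apply: I_bang_contr => //; first by width.
    rewrite -ix; apply: (@par_use es1 (x :: x :: r)); [|by permute|by width].
    exact: target_ctx (target_ctx tr (perm_refl _)) h1.
  by width.
- rewrite ox; apply: I_mono; first apply: I_impR; first by width.
    apply: I_bang_contr => //; first by width.
    rewrite -ix.
    apply: (@par_use es1 (x :: x :: rest)); [left; split=> // | | by width].
      by permute.
    by permute.
  by width.
Qed.

(** The hypothesis [curry bs (Bang (out a))] is the result of a promotion already performed. With
    [x] on the left, its negation turns this into [Bot]; a further [b] moved to the right is again a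
    negation and costs one implication. *)
Lemma rule_promotion x a es bs rest o :
  inn x = Imp (Bang (out a)) Bot -> out x = Bang (out a) ->
  (forall b, b \in bs -> out b = Imp (inn b) Bot) ->
  perm_eq es (x :: bs) -> size es + 4 < w ->
  target es rest o ->
  D (6 * size es + 20) (curry bs (Bang (out a)) :: map inn rest) o.
Proof.
move=> ix ox ob h hw /(target_perm h)/target_cons[[r tr hr]|[hr ->]].
- have sr := target_size tr.
  have main : D (2 * size bs + 3)
      (curry bs (Bang (out a)) :: inn x :: map inn bs) Bot.
    perm_to (inn x :: (curry bs (Bang (out a)) :: map inn bs) ++ [::]).
    rewrite ix; apply: I_mono; first apply: closed_impL; first by width.
    + by apply: curry_elim; width.
    + by apply: I_ax; lia.
    + by rewrite addn1 addn3.
  case: tr => [[hr' ->]|[b hr' ->]].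
  + apply: I_mono; first apply: I_exch main; first by permute.
    by width.
  + rewrite (ob b); last by rewrite (perm_mem hr') mem_head.
    apply: I_mono; first apply: I_impR; first by width.
    apply: I_exch main; first by permute.
    by width.
- perm_to (curry bs (Bang (out a)) :: map inn bs); rewrite ox.
  apply: I_mono; first by apply: curry_elim; width.
  by width.
Qed.

End Rules.

(** * Sequents as lists of signed entries *)

Lemma perm_msetD (X Y : {mset formula}) : perm_eq (X `+` Y) (X ++ Y).
Proof. by apply/allP => a _ /=; rewrite count_cat !count_mem_mset msetE2. Qed.

Lemma perm_mset1D A (X : {mset formula}) : perm_eq (A +` X) (A :: X).
Proof. by have := perm_msetD [mset A] X; rewrite enum_msetn. Qed.

Definition entries (S : sequent) : seq entry :=
  [seq (true, A) | A <- S.1] ++ [seq (false, A) | A <- S.2].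

Lemma entries_left A Ga De :
  perm_eq (entries (A +` Ga, De)) ((true, A) :: entries (Ga, De)).
Proof.
rewrite /entries -cat_cons; apply: perm_cat => //=.
by apply: (perm_map (pair true) (perm_mset1D A Ga)).
Qed.

Lemma entries_right A Ga De :
  perm_eq (entries (Ga, A +` De)) ((false, A) :: entries (Ga, De)).
Proof.
rewrite /entries -(cat1s (false, A)) perm_sym perm_catCA perm_sym.
apply: perm_cat => //=.
by apply: (perm_map (pair false) (perm_mset1D A De)).
Qed.

Lemma entries_cat Ga De Si La :
  perm_eq (entries (Ga `+` Si, De `+` La))
    (entries (Ga, De) ++ entries (Si, La)).
Proof.
have h1 := perm_map (pair true) (perm_msetD Ga Si).
have h2 := perm_map (pair false) (perm_msetD De La).
apply: (perm_trans (perm_cat h1 h2)).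
by apply/permP => p; rewrite /entries !map_cat !count_cat addnACA.
Qed.

Lemma entries0R A : entries (mset0, [mset A]) = [:: (false, A)].
Proof. by rewrite /entries /= enum_mset0 enum_msetn. Qed.

Lemma formula_size_gt0 A : 0 < formula_size A.
Proof. by case: A. Qed.

Lemma size_entries S : size (entries S) < sequent_size S.
Proof.
have h (s : seq formula) : size s <= \sum_(A <- s) formula_size A.
  by rewrite -sum1_size; apply: leq_sum => A _; exact: formula_size_gt0.
by rewrite size_cat !size_map /sequent_size ltnS leq_add.
Qed.

(** * Translated conclusions from translated premises *)

Section Steps.
Context (G : calculus) (s : nat).
Local Notation w := (s + 10).
Local Notation K := (100 * s ^ 2).
Implicit Types (es rest : seq entry).

(** [par_intro] costs at most [s * (7 * s + 23)]. The gap between [90 * s ^ 2] and [K] pays for the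
    inferences that bring in the premises. *)
Lemma step_intro es k Th : size es < s -> size Th <= 2 -> k <= 6 * s + 20 ->
  (forall rest o, target es rest o -> iclosed G w k (Th ++ map inn rest) o) ->
  iclosed G w (90 * s ^ 2) Th (par es).
Proof.
move=> hs hT hk h; apply: I_mono; first by apply: par_intro h; lia.
have : (size es).+1 * (k + size es + 3) <= s * (7 * s + 23).
  by apply: leq_mul; lia.
nia.
Qed.

Lemma step0 es k : size es < s -> k <= 6 * s + 20 ->
  (forall rest o, target es rest o -> iclosed G w k (map inn rest) o) ->
  ideriv G w K [::] [::] (par es).
Proof.
by move=> hs hk h; apply: I_mono; [apply: (@step_intro es k) | lia].
Qed.

(** The leaf is cut in below all conjuncts: it is used once, yet [par es1] is available in every
    branch. *)
Lemma step1 es es1 : size es < s ->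
  (forall rest o, target es rest o ->
     iclosed G w (6 * size es + 20) (par es1 :: map inn rest) o) ->
  ideriv G w K [:: par es1] [::] (par es).
Proof.
move=> hs h; apply: I_mono.
  apply: (@I_cut _ _ _ _ [:: par es1] [::] [::] [::] (par es1)); first by width.
    by apply: I_hyp; lia.
  by apply: (@step_intro es (6 * size es + 20)) => //; lia.
nia.
Qed.

Lemma step2 es es1 es2 : size es < s ->
  (forall rest o, target es rest o ->
     iclosed G w (6 * size es + 20) (par es1 :: par es2 :: map inn rest) o) ->
  ideriv G w K [:: par es1; par es2] [::] (par es).
Proof.
move=> hs h; apply: I_mono.
  apply: (@I_cut _ _ _ _ [:: par es1] [:: par es2] [::] [::] (par es1)).
  - by width.
  - by apply: I_hyp; lia.
  apply: (@I_cut _ _ _ _ [:: par es2] [::] [::] [:: par es1] (par es2)).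
  - by width.
  - by apply: I_hyp; lia.
  apply: (@step_intro es (6 * size es + 20)) => //; first by lia.
  move=> rest o t.
  by apply: I_exch (h _ _ t); permute.
nia.
Qed.

(** With an empty antecedent the two leaves merge into a conjunction by the additive right rule, and
    a single cut brings it in. *)
Lemma step_additive es es1 es2 : size es < s ->
  (forall rest o, target es rest o ->
     iclosed G w (6 * size es + 20)
       (And (par es1) (par es2) :: map inn rest) o) ->
  ideriv G w K [:: par es1; par es2] [::] (par es).
Proof.
move=> hs h; apply: I_mono.
  apply: (@I_cut _ _ _ _ [:: par es1; par es2] [::] [::] [::]
            (And (par es1) (par es2))); first by width.
    apply: (@I_andR _ _ _ _ [:: par es1] [:: par es2]); first by width.
      by apply: I_hyp; lia.
    by apply: I_hyp; lia.
  by apply: (@step_intro es (6 * size es + 20)) => //; lia.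
nia.
Qed.

(** Promotion tolerates only banged formulas in the antecedent, so [par es1] may not stand there.
    The leaf is cut away first, the one target with [A] on the right is promoted and curried, and
    only then are the conjuncts formed. *)
Lemma step_promotion es es1 A Ga : has_exponentials G ->
  let bs := [seq (true, Bang C) | C <- Ga] in
  perm_eq es ((false, Bang A) :: bs) -> perm_eq es1 ((false, A) :: bs) ->
  size es < s -> ideriv G w K [:: par es1] [::] (par es).
Proof.
move=> ex bs h h1 hs.
have E : map inn bs = map Bang (map (chu true) Ga) by rewrite /bs -!map_comp.
have sb : size es = (size bs).+1 by have := perm_size h.
have se : size es1 = (size bs).+1 by have := perm_size h1.
have sG : size Ga = size bs by rewrite /bs size_map.
apply: I_mono.
  apply: (@I_cut _ _ _ _ [:: par es1] [::] [::] [::]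
            (curry bs (Bang (chu true A)))); first by width.
    apply: curry_intro; first by rewrite /=; lia.
    rewrite cat0s E; apply: I_promotion => //; first by rewrite size_map; lia.
    rewrite -E.
    apply: (@I_cut _ _ _ _ [:: par es1] [::] [::] _ (par es1)).
    - by rewrite /= size_map; lia.
    - by apply: I_hyp; lia.
    by apply: par_elim (target_self h1) _; lia.
  apply: (@step_intro es (6 * size es + 20)) => //; first by lia.
  move=> rest o t.
  apply: (@rule_promotion _ _ (false, Bang A) (false, A) es) h _ t => //.
    by move=> b /mapP[C _ ->].
  lia.
nia.
Qed.

End Steps.

Lemma rule_par G Ps S : rule G Ps S ->
  ideriv G (sequent_size S + 10) (100 * sequent_size S ^ 2)
    [seq par (entries P) | P <- Ps] [::] (par (entries S)).
Proof.
move=> r; have hs := size_entries S.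
(* Needed for the axiom, where [compat] costs a multiple of the size of the formula. *)
have hf A : A \in S.1 -> formula_size A <= sequent_size S.
  rewrite /sequent_size => /perm_to_rem h.
  by rewrite (perm_big _ h) big_cons -addnA leqW // leq_addr.
have hw : size (entries S) + 4 < sequent_size S + 10 by lia.
move: (sequent_size S) hs hf hw => s.
case: {Ps S} r => [A|||Ga De|Ga De|Ga De|Ga De|Ga De A B|Ga De A B|Ga De A B
  |Ga De A B|Ga De A B|Ga De A B|Ga De A B|Ga De Si La A B|Ga De Si La A B
  |Ga De A B|Ga De Si La A|Ga De A wk|Ga De A wk|Ga A ex|Ga De A ex|Ga De A ex
  |Ga De A ex] /= hs hf hw.
- have fs : formula_size A <= s by apply: hf; rewrite in_mset1.
  apply: (@step0 _ _ _ (6 * formula_size A).+1) => //; first by lia.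
  move=> rest o; apply: (@rule_ax _ _ (true, A) (false, A)) => //.
  + by rewrite /entries /= !enum_msetn.
  + by lia.
  + by apply: compat; lia.
- apply: (@step0 _ _ _ 1) => //; first by lia.
  move=> rest o; apply: (@rule_one _ _ (false, One)) => //; last by lia.
  by rewrite entries0R.
- apply: (@step0 _ _ _ 1) => //; first by lia.
  move=> rest o; apply: (@rule_one _ _ (true, Zero)) => //; last by lia.
  by rewrite /entries /= enum_mset0 enum_msetn.
- apply: (@step0 _ _ _ 1) => //; first by lia.
  move=> rest o; apply: (@rule_top _ _ (false, Top)) => //.
  exact: entries_right.
- apply: (@step0 _ _ _ 1) => //; first by lia.
  move=> rest o; apply: (@rule_top _ _ (true, Bot)) => //.
  exact: entries_left.
- apply: step1 => //.
  move=> rest o; apply: (@rule_unit _ _ (true, One)) => //.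
  exact: entries_left.
- apply: step1 => //.
  move=> rest o; apply: (@rule_unit _ _ (false, Zero)) => //.
  exact: entries_right.
- apply: step1 => //.
  move=> rest o;
  apply: (@rule_choice _ _ (true, And A B) (true, A) (true, B) (true, A))
    => //; first by left.
  + exact: entries_left.
  + exact: entries_left.
- apply: step1 => //.
  move=> rest o;
  apply: (@rule_choice _ _ (true, And A B) (true, A) (true, B) (true, B))
    => //; first by right.
  + exact: entries_left.
  + exact: entries_left.
- apply: step_additive => //.
  move=> rest o.
  apply: (@rule_additive _ _ (false, And A B) (false, A) (false, B))
    => //.
  + exact: entries_right.
  + exact: entries_right.
  + exact: entries_right.
- apply: step_additive => //.
  move=> rest o.
  apply: (@rule_additive _ _ (true, Or A B) (true, A) (true, B))
    => //.
  + exact: entries_left.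
  + exact: entries_left.
  + exact: entries_left.
- apply: step1 => //.
  move=> rest o;
  apply: (@rule_choice _ _ (false, Or A B) (false, A) (false, B) (false, A))
    => //; first by left.
  + exact: entries_right.
  + exact: entries_right.
- apply: step1 => //.
  move=> rest o;
  apply: (@rule_choice _ _ (false, Or A B) (false, A) (false, B) (false, B))
    => //; first by right.
  + exact: entries_right.
  + exact: entries_right.
- apply: step1 => //.
  move=> rest o; apply: (@rule_join _ _ (true, Tensor A B) (true, A) (true, B))
    => //.
  + exact: entries_left.
  + by apply: perm_trans (entries_left _ _ _) _; rewrite perm_cons entries_left.
- apply: step2 => //.
  move=> rest o.
  apply: (@rule_split _ _ (false, Tensor A B) (false, A) (false, B))
    => //.
  + apply: perm_trans (entries_right _ _ _) _.
    by rewrite perm_cons; exact: entries_cat.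
  + exact: entries_right.
  + exact: entries_right.
- apply: step2 => //.
  move=> rest o.
  apply: (@rule_split _ _ (true, Imp A B) (false, A) (true, B))
    => //.
  + apply: perm_trans (entries_left _ _ _) _.
    by rewrite perm_cons; exact: entries_cat.
  + exact: entries_right.
  + exact: entries_left.
- apply: step1 => //.
  move=> rest o; apply: (@rule_join _ _ (false, Imp A B) (true, A) (false, B))
    => //.
  + exact: entries_right.
  + apply: perm_trans (entries_left _ _ _) _.
    by rewrite perm_cons entries_right.
- apply: step2 => //.
  move=> rest o.
  apply: (@rule_cut _ _ (false, A) (true, A)) => //.
  + exact: entries_cat.
  + exact: entries_right.
  + exact: entries_left.
- apply: step1 => //.
  move=> rest o; apply: (@rule_weak _ _ (true, A)) => //.
  exact: entries_left.
- apply: step1 => //.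
  move=> rest o; apply: (@rule_weak _ _ (false, A)) => //.
  exact: entries_right.
- have e B : perm_eq (entries (seq_mset (map Bang Ga), [mset B]))
      ((false, B) :: [seq (true, Bang C) | C <- Ga]).
    rewrite /entries /= enum_msetn /= cats1 perm_rcons perm_cons.
    rewrite -[[seq (true, Bang C) | C <- Ga]]/(map (pair true \o Bang) Ga).
    by rewrite map_comp; exact: (perm_map _ (perm_eq_seq_mset _)).
  by apply: (@step_promotion _ _ _ _ A Ga).
- apply: step1 => //.
  move=> rest o; apply: (@rule_derel _ _ (true, Bang A) (true, A))
    => //.
  + exact: entries_left.
  + exact: entries_left.
- apply: step1 => //.
  move=> rest o; apply: (@rule_bang_weak _ _ (true, Bang A) (true, A))
    => //.
  exact: entries_left.
- apply: step1 => //.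
  move=> rest o; apply: (@rule_bang_contr _ _ (true, Bang A) (true, A))
    => //.
  + exact: entries_left.
  + by apply: perm_trans (entries_left _ _ _) _; rewrite perm_cons entries_left.
Qed.

(** * Conservative formulas *)

Scheme fully_conservative_mut := Induction for fully_conservative Sort Prop
with conservative_mut := Induction for conservative Sort Prop.
Combined Scheme conservative_mutind
  from fully_conservative_mut, conservative_mut.

Lemma in_language2 G A B : has_exponentials G || (bang_free A && bang_free B) ->
  in_language G A /\ in_language G B.
Proof. by rewrite /in_language; case: has_exponentials => //= /andP. Qed.

Section Conservative.
Context (G : calculus) (w : nat) (hw : 4 < w).
Local Notation D k Ga C := (iclosed G w k Ga C).
Local Notation sz := formula_size.

Lemma and_mono k1 k2 A A' B B' : D k1 [:: A] A' -> D k2 [:: B] B' ->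
  D (k1 + k2 + 3) [:: And A B] (And A' B').
Proof.
move=> dA dB; apply: I_mono; first apply: closed_andR; first by width.
- by apply: I_andL1 dA; width.
- by apply: I_andL2 dB; width.
- by lia.
Qed.

Lemma or_mono k1 k2 A A' B B' : D k1 [:: A] A' -> D k2 [:: B] B' ->
  D (k1 + k2 + 3) [:: Or A B] (Or A' B').
Proof.
move=> dA dB; apply: I_mono; first apply: closed_orL; first by width.
- by apply: I_orR1 dA; width.
- by apply: I_orR2 dB; width.
- by lia.
Qed.

Lemma tensor_mono k1 k2 A A' B B' : D k1 [:: A] A' -> D k2 [:: B] B' ->
  D (k1 + k2 + 2) [:: Tensor A B] (Tensor A' B').
Proof.
move=> dA dB; apply: I_mono; first apply: I_tensorL; first by width.
- by apply: (@closed_tensorR _ _ _ _ [:: A] [:: B]) dA dB; width.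
- by lia.
Qed.

Lemma bang_mono k A A' : has_exponentials G -> D k [:: A] A' ->
  D (k + 2) [:: Bang A] (Bang A').
Proof.
move=> ex dA; rewrite addn2; apply: (@I_promotion _ _ _ _ [:: A]) => //.
  by width.
by apply: I_dereliction dA => //; width.
Qed.

(* The bound is linear for refutations and quadratic for the two implications,
   as a refutation of the succedent is needed in [A => chu true A] when [A] is
   an implication. *)
Lemma chu_conservative_mut :
  (forall A, fully_conservative A -> in_language G A ->
     [/\ D (6 * sz A) [:: chu false A] Bot,
         D (10 * sz A ^ 2) [:: A] (chu true A) &
         D (10 * sz A ^ 2) [:: chu true A] A]) /\
  (forall A, conservative A -> in_language G A ->
     D (10 * sz A ^ 2) [:: A] (chu true A) /\
     D (10 * sz A ^ 2) [:: chu true A] A).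
Proof.
have w3 := ltnW hw; have w2 := ltnW w3; have w1 := ltnW w2; have w0 := ltnW w1.
have swap A B C k : D k [:: A; B] C -> D k [:: B; A] C.
  by apply: I_exch; permute.
have ax A k : 0 < k -> D k [:: A] A by apply: I_mono; exact: I_ax.
apply: conservative_mutind => /=.
- by move=> n _; split; apply: ax.
- by split; apply: ax.
- by split; apply: ax.
- move=> A B _ IA _ IB /in_language2[/IA[nA iA eA] /IB[nB iB eB]]; split.
  + apply: I_mono; first by apply: closed_orL; [| exact: nA | exact: nB].
    lia.
  + by apply: I_mono; [apply: and_mono iA iB | nia].
  + by apply: I_mono; [apply: and_mono eA eB | nia].
- move=> A B _ IA _ IB /in_language2[/IA[nA iA eA] /IB[nB iB eB]]; split.
  + apply: I_mono; first by apply: I_andL1; [| exact: nA].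
    lia.
  + by apply: I_mono; [apply: or_mono iA iB | nia].
  + by apply: I_mono; [apply: or_mono eA eB | nia].
- move=> A B _ IA _ IB /in_language2[/IA[iA eA] /IB[nB iB eB]]; split.
  + apply: I_mono; first apply: I_tensorL => //.
      (* The refutation of [B] gives [Bot], whose left rule absorbs [chu true A] without
         weakening. *)
      apply/swap; apply: (@closed_cut _ _ _ _ [:: _] [:: _] Bot) => //.
        exact: nB.
      exact: I_botL.
    lia.
  + apply: I_mono; first apply: closed_andR => //.
    * apply: I_impR => //; apply/swap.
      apply: (@closed_impL _ _ _ _ [:: _] [::]) => //; [exact: eA | exact: iB].
    (* The contrapositive conjunct is vacuous: [chu false B] already gives [Bot], from which
       [chu false A] follows. *)
    * apply: I_impR => //.
      apply: (@closed_cut _ _ _ _ [:: _] [:: _] Bot) => //; first exact: nB.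
      exact: I_botL.
    * nia.
  + apply: I_mono; first apply: I_andL1 => //.
      apply: I_impR => //; apply/swap.
      apply: (@closed_impL _ _ _ _ [:: _] [::]) => //; [exact: iA | exact: eB].
    nia.
- by split; apply: ax.
- by move=> A _ IA /IA[].
- move=> A B _ IA _ IB /in_language2[/IA[iA eA] /IB[iB eB]].
  split; apply: I_mono;
    [apply: and_mono iA iB | nia | apply: and_mono eA eB | nia].
- move=> A B _ IA _ IB /in_language2[/IA[iA eA] /IB[iB eB]].
  split; apply: I_mono;
    [apply: or_mono iA iB | nia | apply: or_mono eA eB | nia].
- move=> A B _ IA _ IB /in_language2[/IA[iA eA] /IB[iB eB]].
  split; apply: I_mono;
    [apply: tensor_mono iA iB | nia | apply: tensor_mono eA eB | nia].
(* A formula with [Bang] lies in the language only if the calculus has exponentials. *)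
- move=> A _ IA; rewrite /in_language /= orbF => ex.
  have /IA[iA eA] : in_language G A by rewrite /in_language ex.
  split; apply: I_mono;
    [apply: bang_mono ex iA | nia | apply: bang_mono ex eA | nia].
Qed.

End Conservative.

(** Moving the only entry of [par [:: (false, A)]] to the right yields [chu true A], and
    conservativity leads from there back to [A]. *)
Lemma par_conservative G A : conservative A -> in_language G A ->
  ideriv G (sequent_size (mset0, msetn 1 A) + 10)
    (100 * sequent_size (mset0, msetn 1 A) ^ 2)
    [:: par [:: (false, A)]] [::] A.
Proof.
move=> cA lA; set s := sequent_size _.
have hs : s = (formula_size A).+1.
  by rewrite /s /sequent_size /= enum_mset0 enum_msetn /= big_nil big_seq1.
have [|_ eA] := (chu_conservative_mut G (w := s + 10) _).2 A cA lA.
  by lia.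
apply: I_mono.
  apply: (@I_cut _ _ _ _ [:: _] [::] [::] [::] (par [:: (false, A)])).
  - by rewrite /=; lia.
  - by apply: I_hyp; lia.
  apply: (@closed_cut _ _ _ _ [:: _] [::] (chu true A)).
  - by rewrite /=; lia.
  - apply: (@par_elim G (s + 10) [:: (false, A)] [::]); last by rewrite /=; lia.
    exact: (@target_self (false, A)).
  exact: eA.
by rewrite hs /=; nia.
Qed.

(** * From bounded derivations to proofs *)

(* Without exponentials, deleting [!] maps rules to rules, so it brings every
   derivation back into the language of the calculus. *)
Fixpoint erase (ex : bool) (A : formula) : formula :=
  match A with
  | And A B => And (erase ex A) (erase ex B)
  | Or A B => Or (erase ex A) (erase ex B)
  | Tensor A B => Tensor (erase ex A) (erase ex B)
  | Imp A B => Imp (erase ex A) (erase ex B)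
  | Bang A => if ex then Bang (erase ex A) else erase ex A
  | _ => A
  end.

Lemma erase_in_language G A : in_language G (erase (has_exponentials G) A).
Proof.
rewrite /in_language; case: has_exponentials => //=.
by elim: A => //= A -> B ->.
Qed.

Lemma erase_id G A : in_language G A -> erase (has_exponentials G) A = A.
Proof.
rewrite /in_language; case: has_exponentials => /=.
  by move=> _; elim: A => //= [A -> B ->|A -> B ->|A -> B ->|A -> B ->|A ->].
by elim: A => //= A IA B IB /andP[/IA-> /IB->].
Qed.

Definition iseq (G : calculus) (Ga : seq formula) (A : formula) : sequent :=
  (seq_mset (map (erase (has_exponentials G)) Ga),
   [mset erase (has_exponentials G) A]).

Lemma seq_mset_nil : seq_mset (@nil formula) = mset0.
Proof. by apply/msetP => a; rewrite mset_seqE mset0E. Qed.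

Lemma seq_mset_cons (A : formula) s : seq_mset (A :: s) = A +` seq_mset s.
Proof.
by apply/msetP => a; rewrite mset_seqE mset1DE mset_seqE /= eq_sym.
Qed.

Lemma seq_mset_cat (s t : seq formula) :
  seq_mset (s ++ t) = seq_mset s `+` seq_mset t.
Proof. by apply/msetP => a; rewrite msetE2 !mset_seqE count_cat. Qed.

Lemma iseq_in_language G Ga A : sequent_in_language G (iseq G Ga A).
Proof.
apply/andP; split; last by rewrite /= enum_msetn /= erase_in_language.
rewrite (perm_all _ (perm_eq_seq_mset _)) all_map.
by apply/allP => B _; exact: erase_in_language.
Qed.

Lemma iseq_single G Ga A : single_conclusion (iseq G Ga A).
Proof. by rewrite /single_conclusion /= enum_msetn. Qed.

Definition sequent_occ (S : sequent) : nat := size S.1 + size S.2.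

Lemma iseq_occ G Ga A : sequent_occ (iseq G Ga A) = (size Ga).+1.
Proof.
rewrite /sequent_occ /= enum_msetn (perm_size (perm_eq_seq_mset _)) size_map.
by rewrite addn1.
Qed.

(* [linear_deriv R k H S]: a derivation of [S] whose leaves are [H], each used
   once, with at most [k] formula occurrences outside the leaves. *)
Inductive linear_deriv (R : seq sequent -> sequent -> Prop) :
    nat -> seq sequent -> sequent -> Prop :=
| L_hyp S : linear_deriv R 0 [:: S] S
| L_mono k k' H S :
    linear_deriv R k H S -> k <= k' -> linear_deriv R k' H S
| L_inf0 S : R [::] S -> linear_deriv R (sequent_occ S) [::] S
| L_inf1 k H P S : R [:: P] S -> linear_deriv R k H P ->
    linear_deriv R (k + sequent_occ S) H S
| L_inf2 k1 k2 H1 H2 P Q S : R [:: P; Q] S ->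
    linear_deriv R k1 H1 P -> linear_deriv R k2 H2 Q ->
    linear_deriv R (k1 + k2 + sequent_occ S) (H1 ++ H2) S.

(** * Counting occurrences in derivations over multisets *)

Section Linear.
Context (G : calculus) (w : nat).
Local Notation L := (linear_deriv (single_inference G)).
Local Notation sq := (iseq G).

Lemma L_rule0 Ga A : rule G [::] (sq Ga A) -> size Ga < w ->
  L (1 * w) [::] (sq Ga A).
Proof.
move=> r h; apply: L_mono; first apply: L_inf0.
  by split; [split=> //|]; rewrite /= ?iseq_in_language ?iseq_single.
by rewrite iseq_occ mul1n.
Qed.

Lemma L_rule1 k H Ga A Ga1 A1 : rule G [:: sq Ga1 A1] (sq Ga A) ->
  size Ga < w -> L (k * w) H (sq Ga1 A1) -> L (k.+1 * w) H (sq Ga A).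
Proof.
move=> r h d; apply: L_mono; first apply: L_inf1 d.
  by split; [split=> //|]; rewrite /= ?iseq_in_language ?iseq_single.
by rewrite iseq_occ mulSn addnC leq_add2r.
Qed.

Lemma L_rule2 k1 k2 H1 H2 Ga A Ga1 A1 Ga2 A2 :
  rule G [:: sq Ga1 A1; sq Ga2 A2] (sq Ga A) -> size Ga < w ->
  L (k1 * w) H1 (sq Ga1 A1) -> L (k2 * w) H2 (sq Ga2 A2) ->
  L ((k1 + k2).+1 * w) (H1 ++ H2) (sq Ga A).
Proof.
move=> r h d1 d2; apply: L_mono; first apply: L_inf2 d1 d2.
  by split; [split=> //|]; rewrite /= ?iseq_in_language ?iseq_single.
by rewrite iseq_occ mulSn mulnDl addnC leq_add2r.
Qed.

(** Fewer than [w] antecedent formulas and one succedent formula make at most [w] occurrences per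
    inference. *)
Lemma ideriv_linear k H Ga A : ideriv G w k H Ga A ->
  L (k * w) (map (sq [::]) H) (sq Ga A).
Proof.
elim=> {k H Ga A} /=.
- by move=> A _; exact: L_hyp.
- by move=> k k' H Ga C _ d h; apply: L_mono d _; rewrite leq_mul2r h orbT.
(* Exchange disappears: both lists give the same multiset. *)
- move=> k H Ga Ga' C h _.
  suff -> : sq Ga C = sq Ga' C by [].
  by congr pair; apply/eq_seq_msetP; exact: perm_map.
- move=> A h; apply: L_rule0 => //; rewrite /iseq /= seq_mset_cons seq_mset_nil.
  by rewrite msetD0; exact: R_ax.
- move=> h; apply: L_rule0 => //; rewrite /iseq /= seq_mset_nil.
  exact: R_oneR.
- move=> Ga h; apply: L_rule0 => //; rewrite /iseq /=.
  by have := R_topR G (seq_mset (map (erase (has_exponentials G)) Ga)) mset0;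
    rewrite !msetD0.
- move=> Ga C h; apply: L_rule0 => //; rewrite /iseq /= seq_mset_cons.
  exact: R_botL.
- move=> k H Ga C h _; apply: L_rule1 => //; rewrite /iseq /= seq_mset_cons.
  exact: R_oneL.
- move=> k H Ga A B C h _; apply: L_rule1 => //.
  rewrite /iseq /= !seq_mset_cons.
  exact: R_andL1.
- move=> k H Ga A B C h _; apply: L_rule1 => //.
  rewrite /iseq /= !seq_mset_cons.
  exact: R_andL2.
- move=> k1 k2 H1 H2 Ga A B h _ d1 _ d2; rewrite map_cat.
  apply: L_rule2 d1 d2 => //; rewrite /iseq /=.
  (* The rules carry a right context, here empty; [msetD0] makes it visible. *)
  by rewrite -[[mset And _ _]]msetD0 -[[mset erase _ A]]msetD0
    -[[mset erase _ B]]msetD0; exact: R_andR.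
- move=> k1 k2 H1 H2 Ga A B C h _ d1 _ d2; rewrite map_cat.
  apply: L_rule2 d1 d2 => //; rewrite /iseq /= !seq_mset_cons; exact: R_orL.
- move=> k H Ga A B h _; apply: L_rule1 => //; rewrite /iseq /=.
  rewrite -[[mset Or _ _]]msetD0 -[[mset erase _ A]]msetD0; exact: R_orR1.
- move=> k H Ga A B h _; apply: L_rule1 => //; rewrite /iseq /=.
  rewrite -[[mset Or _ _]]msetD0 -[[mset erase _ B]]msetD0; exact: R_orR2.
- move=> k H Ga A B C h _; apply: L_rule1 => //.
  rewrite /iseq /= !seq_mset_cons.
  exact: R_tensorL.
- move=> k1 k2 H1 H2 Ga Si A B h _ d1 _ d2; rewrite map_cat.
  apply: L_rule2 d1 d2; last by rewrite size_cat.
  rewrite /iseq /= map_cat seq_mset_cat.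
  rewrite -[[mset erase _ A]]msetD0 -[[mset erase _ B]]msetD0.
  rewrite -[[mset Tensor _ _]]msetD0 -[X in Tensor _ _ +` X]msetD0.
  exact: R_tensorR.
- move=> k1 k2 H1 H2 Ga Si A B C h _ d1 _ d2; rewrite map_cat.
  apply: L_rule2 d1 d2; last by rewrite /= size_cat.
  rewrite /iseq /= map_cat !seq_mset_cons seq_mset_cat.
  have := R_impL G (seq_mset (map (erase (has_exponentials G)) Ga)) mset0
    (seq_mset (map (erase (has_exponentials G)) Si))
    [mset erase (has_exponentials G) C] (erase (has_exponentials G) A)
    (erase (has_exponentials G) B).
  by rewrite msetD0 mset0D.
- move=> k H Ga A B h _; apply: L_rule1 => //; rewrite /iseq /= seq_mset_cons.
  rewrite -[[mset Imp _ _]]msetD0 -[[mset erase _ B]]msetD0; exact: R_impR.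
- move=> k1 k2 H1 H2 Ga Si A C h _ d1 _ d2; rewrite map_cat.
  apply: L_rule2 d1 d2; last by rewrite /= size_cat.
  rewrite /iseq /= map_cat !seq_mset_cons seq_mset_cat.
  have := R_cut G (seq_mset (map (erase (has_exponentials G)) Ga)) mset0
    (seq_mset (map (erase (has_exponentials G)) Si))
    [mset erase (has_exponentials G) C] (erase (has_exponentials G) A).
  by rewrite msetD0 mset0D.
- move=> k H Ga A C wk h _; apply: L_rule1 => //.
  rewrite /iseq /= seq_mset_cons.
  exact: R_weakL.
- move=> k H Ga A ex h _; apply: L_rule1; last by rewrite size_map.
  have E : map (erase (has_exponentials G)) (map Bang Ga) =
      map Bang (map (erase (has_exponentials G)) Ga).
    by rewrite -!map_comp; apply: eq_map => B /=; rewrite ex.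
  by rewrite /iseq /= E ex; exact: R_promotion.
- move=> k H Ga A C ex h _; apply: L_rule1 => //.
  by rewrite /iseq /= !seq_mset_cons ex; exact: R_dereliction.
- move=> k H Ga A C ex h _; apply: L_rule1 => //.
  by rewrite /iseq /= !seq_mset_cons ex; exact: R_bang_weak.
- move=> k H Ga A C ex h _; apply: L_rule1 => //.
  by rewrite /iseq /= !seq_mset_cons ex; exact: R_bang_contr.
Qed.

End Linear.

(** * Dag-like and tree-like proofs from linear derivations *)

Section Proofs.
Context (R : seq sequent -> sequent -> Prop).

Definition justified (pi : seq sequent) : Prop :=
  forall pre T post, pi = pre ++ T :: post ->
    exists2 Ps, {subset Ps <= pre} & R Ps T.

Lemma justified_rcons pi T :
  justified (rcons pi T) <->
  justified pi /\ exists2 Ps, {subset Ps <= pi} & R Ps T.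
Proof.
split=> [j|[j jT] pre U post].
  split; last by apply: (j pi T [::]); rewrite cats1.
  move=> pre U post E; apply: (j pre U (rcons post T)).
  by rewrite E rcons_cat rcons_cons.
case/lastP: post => [|post V].
  by rewrite cats1 => /rcons_inj[<- <-].
by rewrite -rcons_cons -rcons_cat => /rcons_inj[/j].
Qed.

Lemma occurrences_cat s t :
  occurrences (s ++ t) = occurrences s + occurrences t.
Proof. by rewrite /occurrences big_cat. Qed.

Lemma occurrences_cons T s :
  occurrences (T :: s) = sequent_occ T + occurrences s.
Proof. by rewrite /occurrences big_cons. Qed.

Lemma occurrences_rcons s T :
  occurrences (rcons s T) = occurrences s + sequent_occ T.
Proof. by rewrite -cats1 occurrences_cat /occurrences big_seq1. Qed.

(** The inferences are appended to a sequence that already contains the leaves, so these cost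
    nothing further. A second premise is built on top of the first. *)
Lemma linear_dag k H S sigma : linear_deriv R k H S -> justified sigma ->
  {subset H <= sigma} ->
  exists tau, [/\ justified (sigma ++ tau), S \in sigma ++ tau &
                  occurrences tau <= k].
Proof.
move=> d; elim: d sigma => {k H S}.
- move=> S sigma j sub; exists [::]; rewrite cats0; split=> //.
    by apply: sub; rewrite mem_head.
  by rewrite /occurrences big_nil.
- move=> k k' H S _ IH h sigma j sub; have [tau [jt St ot]] := IH _ j sub.
  by exists tau; split=> //; exact: leq_trans h.
- move=> S r sigma j _; exists [:: S]; rewrite cats1; split.
  + by apply/justified_rcons; split=> //; exists [::].
  + by rewrite mem_rcons mem_head.
  + by rewrite /occurrences big_seq1.
- move=> k H P S r _ IH sigma j sub; have [tau [jt Pt ot]] := IH _ j sub.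
  exists (rcons tau S); rewrite -rcons_cat; split.
  + apply/justified_rcons; split=> //; exists [:: P] => //.
    by move=> x; rewrite inE => /eqP->.
  + by rewrite mem_rcons mem_head.
  + by rewrite occurrences_rcons leq_add2r.
- move=> k1 k2 H1 H2 P Q S r _ IH1 _ IH2 sigma j sub.
  have [|tau1 [jt1 Pt ot1]] := IH1 _ j.
    by move=> x xH; apply: sub; rewrite mem_cat xH.
  have [|tau2 [jt2 Qt ot2]] := IH2 _ jt1.
    by move=> x xH; rewrite mem_cat sub // mem_cat xH orbT.
  exists (rcons (tau1 ++ tau2) S); rewrite -rcons_cat catA; split.
  + apply/justified_rcons; split=> //; exists [:: P; Q] => //.
    move=> x; rewrite !inE => /orP[] /eqP-> //.
    by rewrite mem_cat Pt.
  + by rewrite mem_rcons mem_head.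
  + by rewrite occurrences_rcons leq_add2r occurrences_cat leq_add.
Qed.

(** A proof has to end in [S], so the sequence is truncated right after an occurrence of [S];
    prefixes remain justified. *)
Lemma justified_dag sigma S : justified sigma -> S \in sigma ->
  exists2 tau, dag_proof R tau S & occurrences tau <= occurrences sigma.
Proof.
move=> j Sin; case/path.splitPr: Sin j => pre post j.
exists (rcons pre S).
  split; first by exists pre.
  move: j; rewrite -cat_rcons; move: (rcons pre S) => s j p T q E.
  by apply: (j p T (q ++ post)); rewrite E -catA.
by rewrite -cat_rcons occurrences_cat leq_addr.
Qed.

(** Each leaf is used exactly once, so grafting copies every subtree just once and sizes add. This
    is where linearity keeps trees polynomial. *)
Lemma linear_tree k H S ts : linear_deriv R k H S -> map root ts = H ->
  (forall t, List.In t ts -> derivation R t) ->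
  exists t, [/\ derivation R t, root t = S &
    occurrences (sequents t) <= k + \sum_(u <- ts) occurrences (sequents u)].
Proof.
move=> d; elim: d ts => {k H S}.
- move=> S [|t [|u ts]] //= [<-] h; exists t; split=> //.
    by apply: h; left.
  by rewrite big_seq1.
- move=> k k' H S _ IH h ts E dt; have [t [d r o]] := IH _ E dt.
  by exists t; split=> //; apply: leq_trans o _; rewrite leq_add2r.
- move=> S r [|t ts] // _ _; exists (Node S [::]); split=> //.
  by rewrite big_nil /occurrences /= big_seq1 addn0.
- move=> k H P S r _ IH ts E dt; have [t [d rt o]] := IH _ E dt.
  exists (Node S [:: t]); split=> //.
    constructor; first by rewrite /= rt.
    by move=> u [<-|[]].
  by rewrite /= cats0 occurrences_cons addnC addnAC leq_add2r.
- move=> k1 k2 H1 H2 P Q S r _ IH1 _ IH2 ts E dt.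
  have [ts1 [ts2 [Ets E1 E2]]] :
      exists ts1 ts2,
        [/\ ts = ts1 ++ ts2, map root ts1 = H1 & map root ts2 = H2].
    exists (take (size H1) ts), (drop (size H1) ts).
    by rewrite cat_take_drop map_take map_drop E take_size_cat ?drop_size_cat.
  rewrite {}Ets in dt *.
  have [|t1 [d1 r1 o1]] := IH1 _ E1.
    by move=> t h; apply: dt; apply: List.in_or_app; left.
  have [|t2 [d2 r2 o2]] := IH2 _ E2.
    by move=> t h; apply: dt; apply: List.in_or_app; right.
  exists (Node S [:: t1; t2]); split=> //.
    constructor; first by rewrite /= r1 r2.
    by move=> u [<-|[<-|[]]].
  rewrite /= cats0 occurrences_cons occurrences_cat big_cat /=.
  have := leq_add o1 o2; rewrite addnACA -(leq_add2l (sequent_occ S)) => h.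
  by apply: leq_trans h _; rewrite addnCA addnA.
Qed.

End Proofs.

(** * Translation of whole proofs and the final bound *)

Definition par_sequent (G : calculus) (S : sequent) : sequent :=
  iseq G [::] (par (entries S)).

(** With [s] the size of [S], this bounds [100 * s ^ 2] inferences of width [s + 10], as [s] is
    positive. *)
Definition cost (S : sequent) : nat := 1100 * sequent_size S ^ 3.

Lemma ideriv_cost G H A S :
  ideriv G (sequent_size S + 10) (100 * sequent_size S ^ 2) H [::] A ->
  linear_deriv (single_inference G) (cost S) (map (iseq G [::]) H)
    (iseq G [::] A).
Proof.
move/ideriv_linear => d; apply: L_mono d _; rewrite /cost.
have : 0 < sequent_size S by [].
by move: (sequent_size S) => s; nia.
Qed.

Lemma inference_linear G Ps S : inference G Ps S ->
  linear_deriv (single_inference G) (cost S) (map (par_sequent G) Ps)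
    (par_sequent G S).
Proof. by case=> /rule_par/ideriv_cost; rewrite -map_comp. Qed.

Lemma conservative_linear G A : conservative A -> in_language G A ->
  linear_deriv (single_inference G) (cost (mset0, [mset A]))
    [:: par_sequent G (mset0, [mset A])] (mset0, [mset A]).
Proof.
move=> cA lA; have := ideriv_cost (par_conservative cA lA).
have -> : iseq G [::] A = (mset0, [mset A]).
  by rewrite /iseq seq_mset_nil erase_id.
by rewrite -entries0R.
Qed.

Lemma cost_sum (pi : seq sequent) A : (mset0, [mset A]) \in pi ->
  \sum_(T <- pi) cost T + cost (mset0, [mset A]) <= symbols pi ^ 15.
Proof.
move=> Api; set S := (mset0, _) in Api *.
have hS : 2 <= sequent_size S.
  rewrite /sequent_size /= enum_mset0 enum_msetn /= big_nil big_seq1 add0n ltnS.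
  exact: formula_size_gt0.
have le T : T \in pi -> sequent_size T <= symbols pi.
  by move=> /perm_to_rem h; rewrite /symbols (perm_big _ h) big_cons leq_addr.
have sum3 : \sum_(T <- pi) cost T <= 1100 * symbols pi ^ 3.
  rewrite /cost -big_distrr leq_mul2l /= (expnS _ 2) {1}/symbols big_distrl /=.
  rewrite big_seq [leqRHS]big_seq; apply: leq_sum => T Tpi.
  by rewrite expnS leq_mul2l leq_exp2r // le ?orbT.
have one3 : cost S <= 1100 * symbols pi ^ 3.
  by rewrite /cost leq_mul2l leq_exp2r // le ?orbT.
(* The total is at most [2200 * symbols pi ^ 3]. Since [symbols pi] is at least 2, the factor 2200
   is below [2 ^ 12] and is absorbed by twelve further powers, whence the exponent 15. *)
have big : 2 ^ 12 <= symbols pi ^ 12.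
  by rewrite leq_exp2r // (leq_trans hS) // le.
apply: leq_trans (leq_add sum3 one3) _.
rewrite -mulnDl (expnD _ 12 3) leq_mul2r; apply/orP; right.
exact: leq_trans big.
Qed.

Lemma dag_translation G pi : justified (inference G) pi ->
  exists sigma, [/\ justified (single_inference G) sigma,
    {subset map (par_sequent G) pi <= sigma} &
    occurrences sigma <= \sum_(T <- pi) cost T].
Proof.
elim/last_ind: pi => [|pi T IH].
  move=> _; exists [::]; split=> //; last by rewrite /occurrences !big_nil.
  by case=> [|? ?] ? ? //.
case/justified_rcons=> /IH[sigma [j sub o]] [Ps Pspi /inference_linear d].
have [|tau [jt Tt ot]] := linear_dag d j.
  by move=> x /mapP[P /Pspi Ppi ->]; apply/sub/map_f.
exists (sigma ++ tau); split=> //.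
  move=> x; rewrite map_rcons mem_rcons inE => /orP[/eqP->//|/sub xs].
  by rewrite mem_cat xs.
by rewrite occurrences_cat big_rcons /= leq_add.
Qed.

Lemma tree_translation G t : derivation (inference G) t ->
  exists u, [/\ derivation (single_inference G) u,
    root u = par_sequent G (root t) &
    occurrences (sequents u) <= \sum_(T <- sequents t) cost T].
Proof.
elim=> {t} S ts /inference_linear d _ IH.
have [us [du ru ou]] : exists us,
    [/\ forall u, List.In u us -> derivation (single_inference G) u,
        map root us = map (par_sequent G) (map root ts) &
        \sum_(u <- us) occurrences (sequents u) <=
        \sum_(T <- flatten (map sequents ts)) cost T].
  elim: ts IH {d} => [|t ts IHts] IH.
    by exists [::]; rewrite big_nil; split.
  have [u [du ru ou]] := IH t (or_introl erefl).
  have [us [dus rus ous]] := IHts (fun t' h => IH t' (or_intror h)).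
  exists (u :: us); split=> /=.
  - by move=> v [<-|/dus].
  - by rewrite ru rus.
  - by rewrite big_cons big_cat leq_add.
have [v [dv rv ov]] := linear_tree d ru du.
exists v; split=> //; apply: leq_trans ov _.
by rewrite /= big_cons leq_add2l.
Qed.

Theorem theorem18 (G : calculus) :
  (exists c : nat, forall (A : formula) (pi : seq sequent),
      conservative A -> in_language G A ->
      dag_proof (inference G) pi (mset0, msetn 1 A) ->
      exists sigma : seq sequent,
        dag_proof (single_inference G) sigma (mset0, msetn 1 A) /\
        occurrences sigma <= symbols pi ^ c)
  /\
  (exists c : nat, forall (A : formula) (pi : ptree),
      conservative A -> in_language G A ->
      tree_proof (inference G) pi (mset0, msetn 1 A) ->
      exists sigma : ptree,
        tree_proof (single_inference G) sigma (mset0, msetn 1 A) /\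
        occurrences (sequents sigma) <= symbols (sequents pi) ^ c).
Proof.
(* [d] prolongs the translated proof from the translation of its end sequent to [A] itself. *)
split; exists 15 => A pi cA lA; have d := conservative_linear cA lA.
- case=> [[pi' Epi] /dag_translation[sigma [j sub o]]].
  have Api : (mset0, [mset A]) \in pi by rewrite Epi mem_rcons mem_head.
  have [|tau [jt At ot]] := linear_dag d j.
    by move=> x; rewrite inE => /eqP->; apply/sub/map_f.
  have [rho dr orho] := justified_dag jt At.
  exists rho; split=> //; apply: leq_trans orho _.
  rewrite occurrences_cat; apply: leq_trans (cost_sum Api).
  exact: leq_add.
- case=> /tree_translation[u [du ru ou]] Epi.
  have [||v [dv rv ov]] := linear_tree (ts := [:: u]) d.
  + by rewrite /= ru Epi.
  + by move=> t [<-|[]].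
  exists v; split=> //; apply: leq_trans ov _.
  rewrite big_seq1 addnC.
  have Api : (mset0, [mset A]) \in sequents pi.
    by rewrite -Epi; case: (pi) => S ts; rewrite mem_head.
  by apply: leq_trans (cost_sum Api); rewrite leq_add2r.
Qed.
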